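(* Let $\ell$ be a semi-norm on $\mathbb R^p$ and assume that Conditions L, EMC and MID (stated in the context) are satisfied for this semi-norm. Then with probability at least $1-\alpha-\delta_n$, the regularized minimum distance (RMD) estimator $\hat\theta$ obeys $$\|\hat\theta-\theta_0\|_\ell\le r(\lambda+\epsilon_n;\theta_0,\ell).$$
   Context: Setting. $\Theta\subset\mathbb R^p$, $g:\Theta\to\mathbb R^m$ is a target moment function, $\hat g:\Theta\to\mathbb R^m$ is its (random) empirical version, and $\theta_0\in\Theta$ is the unique solution of $g(\theta_0)=0$. $\alpha\in(0,1)$, $\lambda>0$, $\epsilon_n>0$, $\delta_n>0$ are constants. $\mathcal R(\theta_0)=\{\theta\in\Theta:\|\theta\|_1\le\|\theta_0\|_1\}$. RMD estimator: $\hat\theta$ is a solution of $\min_{\theta\in\Theta}\|\theta\|_1$ subject to $\|\hat g(\theta)\|_\infty\le\lambda$ (an arbitrary element of $\Theta$ if the constraint set is empty). Condition L: $\|\hat g(\theta_0)\|_\infty\le\lambda$ with probability at least $1-\alpha$. Condition EMC: $\sup_{\theta\in\mathcal R(\theta_0)}\|\hat g(\theta)-g(\theta)\|_\infty\le\epsilon_n$ with probability at least $1-\delta_n$. Condition MID: for all $\epsilon>0$, if $\theta\in\mathcal R(\theta_0)$ and $\|g(\theta)-g(\theta_0)\|_\infty\le\epsilon$, then $\|\theta-\theta_0\|_\ell\le r(\epsilon;\theta_0,\ell)$, where $\epsilon\mapsto r(\epsilon;\theta_0,\ell)$ is a weakly increasing function from $[0,\infty)$ to $[0,\infty)$ depending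 on $\theta_0$ and $\ell$. *)

(* Defs.v *)
From mathcomp Require Import all_boot all_order all_algebra.
From mathcomp Require Import all_classical all_reals all_analysis.

Set Implicit Arguments.
Unset Strict Implicit.
Unset Printing Implicit Defensive.

Import Order.TTheory GRing.Theory Num.Theory.
Import numFieldNormedType.Exports.

Local Open Scope classical_set_scope.
Local Open Scope ring_scope.

(* The vectors of R^k are the row vectors ['rV[R]_k].  The library norm [`|x|]
   on matrices is [mx_norm], the largest absolute value of an entry: on
   ['rV[R]_k] it is the sup-norm, and it is used as such below. *)

Definition norm1 (R : realType) (p : nat) (x : 'rV[R]_p) : R :=
  \sum_(j < p) `|x ord0 j|.

(* Nonnegativity of [l] and [l 0 = 0] follow from these two properties. *)
Definition is_seminorm (R : realType) (p : nat) (l : 'rV[R]_p -> R) : Prop :=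
  (forall x y, l (x + y) <= l x + l y) /\
  (forall (a : R) x, l (a *: x) = `|a| * l x).

(* Neither a supremum over an uncountable set of parameters nor a solution of
   an optimization problem need be measurable, so "A holds with probability at
   least q" asks for a measurable event of probability at least q on which A
   holds; see [with_prob_geE] for a measurable A. *)
Definition with_prob_ge (d : measure_display) (T : measurableType d)
    (R : realType) (P : probability T R) (q : R) (A : set T) : Prop :=
  exists E : set T, [/\ measurable E, E `<=` A & (q%:E <= P E)%E].

Lemma with_prob_geE (d : measure_display) (T : measurableType d)
    (R : realType) (P : probability T R) (q : R) (A : set T) :
  measurable A -> with_prob_ge P q A <-> (q%:E <= P A)%E.
Proof.
move=> mA; split=> [[E [mE EA qE]]|qA]; last by exists A; split.
by apply: (le_trans qE); apply: le_measure; rewrite ?inE.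
Qed.

Definition random_moments (d : measure_display) (T : measurableType d)
    (R : realType) (p m : nat) (Theta : set 'rV[R]_p)
    (ghat : T -> 'rV[R]_p -> 'rV[R]_m) : Prop :=
  forall theta, Theta theta -> forall i : 'I_m,
    measurable_fun [set: T] (fun w => ghat w theta ord0 i).

Definition unique_zero (R : realType) (p m : nat) (Theta : set 'rV[R]_p)
    (g : 'rV[R]_p -> 'rV[R]_m) (theta0 : 'rV[R]_p) : Prop :=
  [/\ Theta theta0, g theta0 = 0 &
      forall theta, Theta theta -> g theta = 0 -> theta = theta0].

Definition restricted_set (R : realType) (p : nat) (Theta : set 'rV[R]_p)
    (theta0 : 'rV[R]_p) : set 'rV[R]_p :=
  [set theta | Theta theta /\ norm1 theta <= norm1 theta0].

Definition rmd_constraint (R : realType) (p m : nat) (Theta : set 'rV[R]_p)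
    (gh : 'rV[R]_p -> 'rV[R]_m) (lambda : R) : set 'rV[R]_p :=
  [set theta | Theta theta /\ `|gh theta| <= lambda].

(* [gh] and [thetah] are the realizations of the empirical moment function and
   of the estimator; when the constraint set is empty, [thetah] is any point
   of [Theta]. *)
Definition is_rmd (R : realType) (p m : nat) (Theta : set 'rV[R]_p)
    (gh : 'rV[R]_p -> 'rV[R]_m) (lambda : R) (thetah : 'rV[R]_p) : Prop :=
  Theta thetah /\
  (rmd_constraint Theta gh lambda !=set0 ->
   rmd_constraint Theta gh lambda thetah /\
   forall theta, rmd_constraint Theta gh lambda theta ->
     norm1 thetah <= norm1 theta).

Definition condition_L (d : measure_display) (T : measurableType d)
    (R : realType) (P : probability T R) (p m : nat)
    (ghat : T -> 'rV[R]_p -> 'rV[R]_m) (theta0 : 'rV[R]_p)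
    (alpha lambda : R) : Prop :=
  with_prob_ge P (1 - alpha) [set w | `|ghat w theta0| <= lambda].

(* The supremum is taken in the extended reals, hence is +oo if the deviations
   are unbounded. *)
Definition condition_EMC (d : measure_display) (T : measurableType d)
    (R : realType) (P : probability T R) (p m : nat) (Theta : set 'rV[R]_p)
    (g : 'rV[R]_p -> 'rV[R]_m) (ghat : T -> 'rV[R]_p -> 'rV[R]_m)
    (theta0 : 'rV[R]_p) (eps delta : R) : Prop :=
  with_prob_ge P (1 - delta)
    [set w | (ereal_sup [set `|ghat w theta - g theta|%:E |
                theta in restricted_set Theta theta0] <= eps%:E)%E].

(* [r e theta0 l] only matters for [0 <= e], where it is nonnegative and weakly
   increasing in [e]. *)
Definition condition_MID (R : realType) (p m : nat) (Theta : set 'rV[R]_p)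
    (g : 'rV[R]_p -> 'rV[R]_m) (theta0 : 'rV[R]_p) (l : 'rV[R]_p -> R)
    (r : R -> 'rV[R]_p -> ('rV[R]_p -> R) -> R) : Prop :=
  [/\ forall e, 0 <= e -> 0 <= r e theta0 l,
      forall e e', 0 <= e -> e <= e' -> r e theta0 l <= r e' theta0 l &
      forall e, 0 < e -> forall theta, restricted_set Theta theta0 theta ->
        `|g theta - g theta0| <= e -> l (theta - theta0) <= r e theta0 l].

(* Main.v *)
Require Import Defs.
From mathcomp Require Import all_boot all_order all_algebra.
From mathcomp Require Import all_classical all_reals all_analysis.
From mathcomp Require Import lra.

Import Order.TTheory GRing.Theory Num.Theory.
Import numFieldNormedType.Exports.

Local Open Scope classical_set_scope.
Local Open Scope ring_scope.

(** Everything happens on the event where the bounds of Conditions L and EMC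
    both hold; by the union bound on complements ([with_prob_geI]) it has
    probability at least [1 - alpha - delta_n], and there the argument is
    deterministic.  The true parameter is feasible, so the estimator is feasible
    too and its l1-norm is at most that of [theta0]: it lies in the restricted
    set, where the empirical moments are uniformly [eps_n]-close to the target
    ones.  As [g theta0 = 0], the triangle inequality through
    [ghat thetahat] gives
    [`|g thetahat - g theta0| <= eps_n + lambda], and Condition MID converts
    this bound on moments into one on parameters. *)

Lemma with_prob_geS (d : measure_display) (T : measurableType d)
    (R : realType) (P : probability T R) (q : R) (A B : set T) :
  A `<=` B -> with_prob_ge P q A -> with_prob_ge P q B.
Proof.
by move=> AB [E [mE EA qE]]; exists E; split=> //; exact: subset_trans AB.
Qed.
Arguments with_prob_geS {d T R P q A B}.

(** Bonferroni's inequality: the failure probabilities [a] and [b] of two events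
    add up by subadditivity of [P] on the complements. *)
Lemma with_prob_geI (d : measure_display) (T : measurableType d)
    (R : realType) (P : probability T R) (a b : R) (A B : set T) :
  with_prob_ge P (1 - a) A -> with_prob_ge P (1 - b) B ->
  with_prob_ge P (1 - a - b) (A `&` B).
Proof.
move=> [E [mE EA aE]] [F [mF FB bF]].
exists (E `&` F); split; [exact: measurableI|exact: setISS|].
have mEF : measurable (E `&` F) by exact: measurableI.
have subadd : (P (~` (E `&` F)) <= P (~` E) + P (~` F))%E.
  by rewrite setCI; apply: measureU2; exact: measurableC.
have PE X : measurable X -> P X = (fine (P X))%:E.
  by move=> mX; rewrite fineK //; exact: fin_num_measure.
move: aE bF subadd; rewrite !probability_setC // (PE E) // (PE F) // (PE _ mEF).
by rewrite -!EFinB -EFinD !lee_fin; lra.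
Qed.
Arguments with_prob_geI {d T R P a b A B}.

(** On the event of Condition L the constraint set contains [theta0], so
    minimality of the estimator bounds its l1-norm. *)
Lemma is_rmd_restricted (R : realType) (p m : nat) (Theta : set 'rV[R]_p)
    (gh : 'rV[R]_p -> 'rV[R]_m) (lambda : R) (theta0 thetah : 'rV[R]_p) :
  Theta theta0 -> `|gh theta0| <= lambda -> is_rmd Theta gh lambda thetah ->
  restricted_set Theta theta0 thetah /\ `|gh thetah| <= lambda.
Proof.
move=> Theta0 gh0 [_ rmd].
have feas0 : rmd_constraint Theta gh lambda theta0 by [].
have [[Thetah ghh] minh] := rmd (ex_intro _ theta0 feas0).
by split=> //; split=> //; exact: minh.
Qed.
Arguments is_rmd_restricted {R p m Theta gh lambda theta0 thetah}.

Theorem proposition3p1 (d : measure_display) (T : measurableType d)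
    (R : realType) (P : probability T R) (p m : nat) (Theta : set 'rV[R]_p)
    (g : 'rV[R]_p -> 'rV[R]_m) (ghat : T -> 'rV[R]_p -> 'rV[R]_m)
    (theta0 : 'rV[R]_p) (thetahat : T -> 'rV[R]_p)
    (alpha lambda eps_n delta_n : R) (l : 'rV[R]_p -> R)
    (r : R -> 'rV[R]_p -> ('rV[R]_p -> R) -> R)
    (ghat_random : random_moments Theta ghat)
    (theta0_zero : unique_zero Theta g theta0)
    (alpha01 : 0 < alpha < 1) (lambda_gt0 : 0 < lambda)
    (eps_gt0 : 0 < eps_n) (delta_gt0 : 0 < delta_n)
    (thetahat_rmd : forall w, is_rmd Theta (ghat w) lambda (thetahat w))
    (l_seminorm : is_seminorm l)
    (L : condition_L P ghat theta0 alpha lambda)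
    (EMC : condition_EMC P Theta g ghat theta0 eps_n delta_n)
    (MID : condition_MID Theta g theta0 l r) :
  with_prob_ge P (1 - alpha - delta_n)
    [set w | l (thetahat w - theta0) <= r (lambda + eps_n) theta0 l].
Proof.
case: theta0_zero MID => Theta0 g0 _ [_ _ mid].
apply: with_prob_geS (with_prob_geI L EMC) => w /= [Lw EMCw].
have [thR ghw] := is_rmd_restricted Theta0 Lw (thetahat_rmd w).
apply: mid => //; first exact: addr_gt0.
have dev : `|ghat w (thetahat w) - g (thetahat w)| <= eps_n.
  rewrite -lee_fin; apply: le_trans EMCw.
  by apply: ereal_sup_ubound; exists (thetahat w).
rewrite g0 subr0.
rewrite -[g (thetahat w)](subKr (ghat w (thetahat w))).
by apply: le_trans (ler_normB _ _) _; exact: lerD.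
Qed.
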